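(* Consider the rank one PCP model for $\boldsymbol{\mathscr X}\in\mathbb N_0^{N_1\times\cdots\times N_P}$ with positive factor vectors $\boldsymbol a_p\in\mathbb R_+^{N_p}$ and parameter vector $\boldsymbol\theta=[\boldsymbol a_1^\top\cdots\boldsymbol a_P^\top]^\top$. Let $\boldsymbol x_p=\mathbf X_{(p)}\mathbf 1_{N/N_p}$, $\lambda_p=\mathbf 1_{N_p}^\top\boldsymbol a_p$, $\lambda=\prod_{p=1}^P\lambda_p$, and $\lambda_{pq}=\lambda_p\lambda_q$. If $\boldsymbol x_p$ is a positive vector for every $p\in\{1,\dots,P\}$, then the observed Fisher information matrix is $$\mathcal I_{obs}(\boldsymbol\theta,\boldsymbol x)=\begin{bmatrix}\mathrm{diag}(\boldsymbol x_1\oslash\boldsymbol a_1^{*2})&\lambda\lambda_{12}^{-1}\mathbf 1_{N_1}\mathbf 1_{N_2}^\top&\cdots&\lambda\lambda_{1P}^{-1}\mathbf 1_{N_1}\mathbf 1_{N_P}^\top\\ \lambda\lambda_{12}^{-1}\mathbf 1_{N_2}\mathbf 1_{N_1}^\top&\mathrm{diag}(\boldsymbol x_2\oslash\boldsymbol a_2^{*2})&\cdots&\lambda\lambda_{2P}^{-1}\mathbf 1_{N_2}\mathbf 1_{N_P}^\top\\ \vdots&\vdots&\ddots&\vdots\\ \lambda\lambda_{1P}^{-1}\mathbf 1_{N_P}\mathbf 1_{N_1}^\top&\lambda\lambda_{P2}^{-1}\mathbf 1_{N_P}\mathbf 1_{N_2}^\top&\cdots&\mathrm{diag}(\boldsymbol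 x_P\oslash\boldsymbol a_P^{*2})\end{bmatrix},$$ and the expected Fisher information matrix is $$\mathcal I(\boldsymbol\theta)=\lambda\begin{bmatrix}\lambda_1^{-1}\mathrm{diag}(\boldsymbol a_1)^{-1}&\lambda_{12}^{-1}\mathbf 1_{N_1}\mathbf 1_{N_2}^\top&\cdots&\lambda_{1P}^{-1}\mathbf 1_{N_1}\mathbf 1_{N_P}^\top\\ \lambda_{12}^{-1}\mathbf 1_{N_2}\mathbf 1_{N_1}^\top&\lambda_2^{-1}\mathrm{diag}(\boldsymbol a_2)^{-1}&\cdots&\lambda_{2P}^{-1}\mathbf 1_{N_2}\mathbf 1_{N_P}^\top\\ \vdots&\vdots&\ddots&\vdots\\ \lambda_{1P}^{-1}\mathbf 1_{N_P}\mathbf 1_{N_1}^\top&\lambda_{P2}^{-1}\mathbf 1_{N_P}\mathbf 1_{N_2}^\top&\cdots&\lambda_P^{-1}\mathrm{diag}(\boldsymbol a_P)^{-1}\end{bmatrix}.$$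
   Context: Rank one PCP model: independent entries $x_{\boldsymbol i}\sim\mathrm{Poisson}\big(\prod_{p=1}^P\boldsymbol a_p(i_p)\big)$, $\boldsymbol i=(i_1,\dots,i_P)$; $\boldsymbol x=\mathrm{vec}(\boldsymbol{\mathscr X})$; $N=N_1\cdots N_P$; $\mathbb R_+$ denotes the positive reals. The loglikelihood is $\ell(\boldsymbol x|\boldsymbol\theta)=\sum_{p=1}^P\boldsymbol x_p^\top\log(\boldsymbol a_p)-\lambda+C$, with $C$ not depending on $\boldsymbol\theta$ and $\log$ entrywise. $\mathcal I_{obs}(\boldsymbol\theta,\boldsymbol x)=-\nabla^2_{\boldsymbol\theta,\boldsymbol\theta}\ell(\boldsymbol x|\boldsymbol\theta)$ for the observed data $\boldsymbol x$, and $\mathcal I(\boldsymbol\theta)=\mathbb E[-\nabla^2_{\boldsymbol\theta,\boldsymbol\theta}\ell(\boldsymbol x|\boldsymbol\theta)]$, expectation over $\boldsymbol x$ under the model with parameter $\boldsymbol\theta$. $\mathbf X_{(p)}\in\mathbb R^{N_p\times N/N_p}$ is the mode-$p$ matricization, so the entry $i_p$ of $\boldsymbol x_p$ is the sum of all entries of $\boldsymbol{\mathscr X}$ whose $p$-th index equals $i_p$. $\mathbf 1_n$ is the all-ones vector of length $n$; $\oslash$ and $(\cdot)^{*2}$ are entrywise division and square. *)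

(* Defs.v *)
From HB Require Import structures.
From mathcomp Require Import all_boot all_order all_algebra.
From mathcomp Require Import all_classical all_reals all_analysis.

Set Implicit Arguments.
Unset Strict Implicit.
Unset Printing Implicit Defensive.

Import Order.TTheory GRing.Theory Num.Theory.
Import numFieldNormedType.Exports.

Local Open Scope classical_set_scope.
Local Open Scope ring_scope.

Definition ones (R : realType) (n : nat) : 'cV[R]_n := const_mx 1.

Section Tensor.
Context {P : nat} (N : 'I_P -> nat).

Definition multi_index := {dffun forall p : 'I_P, 'I_(N p)}.

Definition count_tensor := multi_index -> nat.

(* Mixed-radix position of the column holding the entry i in the mode-p
   matricization: the remaining indices i q, q != p, are read with the first
   one varying fastest. *)
Definition mode_column (p : 'I_P) (i : multi_index) : nat :=
  (\sum_(q < P | q != p) i q * \prod_(r < P | (r < q) && (r != p)) N r)%N.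

(* Exactly one multi-index contributes to the sum defining each entry. *)
Definition matricization (R : realType) (x : count_tensor) (p : 'I_P) :
    'M[R]_(N p, (\prod_(q < P) N q) %/ N p) :=
  \matrix_(j, k)
    \sum_(i : multi_index | (i p == j) && (mode_column p i == k)) (x i)%:R.

Definition mode_sum (R : realType) (x : count_tensor) (p : 'I_P) :
    'cV[R]_(N p) :=
  matricization R x p *m ones R _.

End Tensor.

Lemma mode_column_lt (P : nat) (N : 'I_P -> nat) (p : 'I_P) (i : multi_index N) :
  (mode_column p i < (\prod_(q < P) N q) %/ N p)%N.
Proof.
have N0 q : (0 < N q)%N by apply: leq_ltn_trans (ltn_ord (i q)).
have -> : ((\prod_(q < P) N q) %/ N p = \prod_(q < P | q != p) N q)%N.
  by rewrite (bigD1 p) //= mulKn.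
suff H n : (n <= P)%N ->
    (\sum_(q < P | (q < n) && (q != p))
        i q * \prod_(r < P | (r < q) && (r != p)) N r
     < \prod_(q < P | (q < n) && (q != p)) N q)%N.
  have := H P (leqnn _).
  rewrite (eq_bigl (fun q : 'I_P => q != p)); last by move=> q; rewrite ltn_ord.
  by rewrite [X in (_ < X)%N](eq_bigl (fun q : 'I_P => q != p)) // => q; rewrite ltn_ord.
elim: n => [_|n IH nP]; first by rewrite !big_pred0.
have {IH} := IH (ltnW nP).
pose o := Ordinal nP.
have [op|op] := eqVneq o p.
  have E : (fun q : 'I_P => (q < n.+1)%N && (q != p)) =1 (fun q : 'I_P => (q < n)%N && (q != p)).
    move=> q; rewrite ltnS leq_eqVlt.
    case: (eqVneq q p) => [|qp]; rewrite ?andbF // !andbT.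
    have -> // : (nat_of_ord q == n) = false.
    by apply/negP => /eqP h; case/eqP: qp; rewrite -op; apply/val_inj.
  by rewrite !(eq_bigl _ _ E).
have E (q : 'I_P) : (q < n.+1)%N && (q != p) && (q != o) = (q < n)%N && (q != p).
  rewrite ltnS leq_eqVlt -(inj_eq val_inj q o) /=.
  by case: (ltngtP q n) => //= _; case: (q != p).
rewrite [in X in _ -> X](bigD1 o) /= ?ltnSn //.
rewrite [X in _ -> (_ < X)%N](bigD1 o) /= ?ltnSn //.
rewrite !(eq_bigl _ _ E).
set A := (\prod_(_ < P | _) _)%N; set S := (\sum_(_ < P | _) _)%N => SA.
have := ltn_ord (i o) => iN.
apply: (@leq_trans (i o * A + A)%N); first by rewrite ltn_add2l.
by rewrite -mulSnr leq_mul2r iN orbT.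
Qed.

Lemma mode_sumE (R : realType) (P : nat) (N : 'I_P -> nat)
    (x : count_tensor N) (p : 'I_P) (j : 'I_(N p)) :
  mode_sum R x p j 0 = \sum_(i : multi_index N | i p == j) (x i)%:R.
Proof.
rewrite mxE (eq_bigr (fun k : 'I_ _ => \sum_(i : multi_index N | (i p == j) && (mode_column p i == k)) (x i)%:R)); last first.
  by move=> k _; rewrite !mxE mulr1.
rewrite [RHS](partition_big (fun i => Ordinal (mode_column_lt p i)) xpredT) //=.
Qed.

Section Calculus.
Context {R : realType} {n : nat}.
Implicit Types (f : 'cV[R]_n -> R) (y : 'cV[R]_n).

Definition partial f (k : 'I_n) y : R := 'D_(delta_mx k 0) f y.

Definition hessian f y : 'M[R]_n := \matrix_(j, k) partial (partial f k) j y.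

(* All the limits entering [hessian f y] exist; ['D_v] is otherwise a default
   value. *)
Definition twice_derivable f y : Prop :=
  (\forall z \near y, forall k : 'I_n, derivable f z (delta_mx k 0)) /\
  (forall j k : 'I_n, derivable (partial f k) y (delta_mx j 0)).

End Calculus.

Section RankOnePCP.
Context {R : realType} {P : nat} {N : 'I_P -> nat}.

Definition rank1_mean (a : forall p, 'cV[R]_(N p)) (i : multi_index N) : R :=
  \prod_(p < P) a p (i p) 0.

(* The parameter stacks the factor vectors; [submxcol theta p] is the p-th. *)
Definition loglik (x : count_tensor N) (theta : 'cV[R]_(\sum_(p < P) N p)) : R :=
  ln (\prod_(i : multi_index N)
        poisson_pmf (rank1_mean (fun p => submxcol theta p) i) (x i)).

Definition observed_info (theta : 'cV[R]_(\sum_(p < P) N p))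
    (x : count_tensor N) : 'M[R]_(\sum_(p < P) N p) :=
  - hessian (loglik x) theta.

Section Random.
Context {d : measure_display} {T : measurableType d} (Pr : probability T R).
Variable X : multi_index N -> {RV Pr >-> nat}.

(* The index type being finite, taking [B i := setT] off a subfamily gives the
   product rule on every subfamily. *)
Definition mutually_independent : Prop :=
  forall B : multi_index N -> set nat, (forall i, measurable (B i)) ->
    Pr (\bigcap_(i in [set: multi_index N]) (X i @^-1` B i)) =
    (\prod_(i : multi_index N) Pr (X i @^-1` B i))%E.

(* The second argument of [poisson_prob] is ignored by its definition. *)
Definition rank1_PCP_model (theta : 'cV[R]_(\sum_(p < P) N p)) : Prop :=
  mutually_independent /\
  forall (i : multi_index N) (U : set nat),
    distribution Pr (X i) U =
    poisson_prob (rank1_mean (fun p => submxcol theta p) i) 0%N U.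

(* Entries are kept in the extended reals, so that an entry equal to [r%:E]
   is a finite expectation. *)
Definition expected_info (theta : 'cV[R]_(\sum_(p < P) N p)) :
    'M[\bar R]_(\sum_(p < P) N p) :=
  \matrix_(j, k)
    'E_Pr[fun w => observed_info theta (fun i => X i w) j k]%E.

End Random.
End RankOnePCP.

(* Main.v *)
Require Import Defs.
From HB Require Import structures.
From mathcomp Require Import all_boot all_order all_algebra.
From mathcomp Require Import all_classical all_reals all_analysis.
From mathcomp Require Import measurable_realfun.
From mathcomp Require Import ring.

Set Implicit Arguments.
Unset Strict Implicit.
Unset Printing Implicit Defensive.

Import Order.TTheory GRing.Theory Num.Theory.
Import numFieldNormedType.Exports.

Local Open Scope classical_set_scope.
Local Open Scope ring_scope.

(** On the cone of positive parameters y the loglikelihood is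

      sum_k c_k ln y_k  -  prod_p b_p(y)  +  constant,

    where k runs over the coordinates of the stacked parameter, c_k is the
    marginal count of the category k, and b_p(y) is the sum of the p-th block
    of y.  The logarithm of a Poisson mean prod_p y_(p, i_p) splits into one
    term per mode, and collecting those terms by category gives the c_k
    ([loglikE]); the total mean, a sum over multi-indices of products, factors
    by distributivity into the product of the block sums ([prod_sum_dffun]).

    Moving y along one basis vector changes one y_k and, at unit speed, one
    b_p, so the product of the block sums is affine along that line.  Hence the
    second derivative of the product is 0 within a block and, across two
    blocks, the product of the remaining block sums; the logarithms only
    contribute - c_k / y_k^2 on the diagonal ([is_derive_loglik],
    [is_derive_score]).  This is the observed information.

    It depends on the data only through the c_k, and linearly.  So the expected
    information needs just the mean of c_k, which is the sum of the Poisson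
    means over the slice k of the tensor, i.e. y_k times the product of the
    other block sums ([sum_stacked_mean_slice], [poisson_RV_mean]).  One of the
    two factors y_k in the denominator cancels, leaving
    lambda / (lambda_p y_k). *)

(** * Products of sums over dependent indices *)

Section Distributivity.

(** A choice of one factor per index is a dependent function; distributivity
    over non-dependent ones applies after embedding every [J p] into their
    disjoint union. *)
Lemma prod_sum_dffun (A : comPzRingType) (I : finType) (J : I -> finType)
    (F : forall p, J p -> A) :
  \prod_(p : I) \sum_(j : J p) F p j =
  \sum_(i : {dffun forall p : I, J p}) \prod_(p : I) F p (i p).
Proof.
pose G p : {ffun J p -> A} := [ffun j => F p j].
transitivity (\prod_(p : I) \sum_(j : J p) G p j).
  by apply: eq_bigr => p _; apply: eq_bigr => j _; rewrite ffunE.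
transitivity (\sum_(t : fprod J) \prod_(p : I) G p (t p)).
  rewrite big_fprod.
  rewrite -(bigA_distr_big_dep (fun p => tagged_with J p)
              (fun p t => untag 0 (G p) t)).
  by apply: eq_bigr => p _; rewrite (big_tag (fun p j => G p j)).
rewrite (reindex (@fprod_of_dffun I J)); last first.
  exact/onW_bij/fprod_of_dffun_bij.
apply: eq_bigr => i _; apply: eq_bigr => p _.
by rewrite ffunE -[in RHS](fprod_of_dffunK i) ffunE.
Qed.

End Distributivity.

(** * Coordinates of the stacked parameter *)

Section Stacking.
Context {P : nat} {N : 'I_P -> nat}.
Implicit Types (p : 'I_P) (k : 'I_(\sum_(p < P) N p)).

Lemma eq_RankE p (j l : 'I_(N p)) :
  (tagnat.Rank p j == tagnat.Rank p l) = (j == l).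
Proof. by rewrite -val_eqE tagnat.eq_Rank eqxx val_eqE. Qed.

Lemma sum_stacked (V : nmodType) (F : 'I_(\sum_(p < P) N p) -> V) :
  \sum_k F k = \sum_(p < P) \sum_(j < N p) F (tagnat.Rank p j).
Proof.
rewrite sig_big_dep (reindex tagnat.rank) /=; last exact: tagnat.rank_bij_on.
by apply: eq_bigr => t _; rewrite tagnat.rankE.
Qed.

Lemma sum_Rank_eq (A : pzRingType) p k :
  \sum_(j < N p) (tagnat.Rank p j == k)%:R = (p == tagnat.sig1 k)%:R :> A.
Proof.
have [->|pk] := eqVneq p (tagnat.sig1 k); last first.
  apply: big1 => j _; case: eqVneq => // jk.
  by rewrite -jk tagnat.Rank1K eqxx in pk.
rewrite (bigD1 (tagnat.sig2 k)) //= tagnat.sig2K eqxx big1 ?addr0 // => j.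
by rewrite -eq_RankE tagnat.sig2K => /negPf ->.
Qed.

Lemma sum_Rank_eq_mul (A : pzRingType) p k (F : 'I_(\sum_(p < P) N p) -> A) :
  \sum_(j < N p) (if tagnat.Rank p j == k then F (tagnat.Rank p j) else 0) =
  (p == tagnat.sig1 k)%:R * F k.
Proof.
rewrite -sum_Rank_eq mulr_suml; apply: eq_bigr => j _.
by case: eqVneq => [->|]; rewrite ?mul1r ?mul0r.
Qed.

End Stacking.

(** * The loglikelihood in stacked coordinates *)

Section Counts.
Context {R : realType} {P : nat} {N : 'I_P -> nat}.
Implicit Types (x : count_tensor N) (y : 'cV[R]_(\sum_(p < P) N p)).
Implicit Types (p : 'I_P) (k : 'I_(\sum_(p < P) N p)).

Definition stacked_counts x : 'cV[R]_(\sum_(p < P) N p) :=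
  \mxcol_(p < P) mode_sum R x p.

Definition block_sum y p : R := \sum_(j < N p) y (tagnat.Rank p j) 0.

Definition stacked_mean y (i : multi_index N) : R :=
  \prod_(p < P) y (tagnat.Rank p (i p)) 0.

(** Reading the mean off the stacked vector, rather than off its blocks, makes
    it a function of plain coordinates, which is what a directional derivative
    acts on. *)
Lemma rank1_meanE y i : rank1_mean (fun p => submxcol y p) i = stacked_mean y i.
Proof. by apply: eq_bigr => p _; rewrite mxE. Qed.

Lemma stacked_mean_gt0 y i : (forall k, 0 < y k 0) -> 0 < stacked_mean y i.
Proof. by move=> y0; apply: prodr_gt0. Qed.

Lemma stacked_countsE x k :
  stacked_counts x k 0 =
  \sum_(i : multi_index N | tagnat.Rank _ (i (tagnat.sig1 k)) == k) (x i)%:R.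
Proof.
rewrite mxE mode_sumE; apply: eq_bigl => i.
by rewrite -eq_RankE tagnat.sig2K.
Qed.

Lemma stacked_counts_Rank x p (j : 'I_(N p)) :
  stacked_counts x (tagnat.Rank p j) 0 =
  \sum_(i : multi_index N | i p == j) (x i)%:R.
Proof.
rewrite stacked_countsE tagnat.Rank1K.
by apply: eq_bigl => i; rewrite eq_RankE.
Qed.

Lemma sum_stacked_mean y :
  \sum_(i : multi_index N) stacked_mean y i = \prod_(p < P) block_sum y p.
Proof. by rewrite prod_sum_dffun. Qed.

(** Setting to zero the coordinates of the block of [k] other than [k] kills
    exactly the means outside the slice, so the restricted sum becomes a full
    one and factors. *)
Lemma sum_stacked_mean_slice y k :
  \sum_(i : multi_index N | tagnat.Rank _ (i (tagnat.sig1 k)) == k)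
     stacked_mean y i =
  y k 0 * \prod_(p < P | p != tagnat.sig1 k) block_sum y p.
Proof.
pose z : 'cV[R]_(\sum_(p < P) N p) :=
  \col_l (if (tagnat.sig1 l == tagnat.sig1 k) && (l != k) then 0 else y l 0).
have zE l : (tagnat.sig1 l != tagnat.sig1 k) || (l == k) -> z l 0 = y l 0.
  by rewrite mxE; case: eqP => //= _ ->.
have <- : z k 0 = y k 0 by rewrite zE ?eqxx ?orbT.
transitivity (\sum_(i : multi_index N) stacked_mean z i).
  rewrite big_mkcond; apply: eq_bigr => i _; case: ifPn => [ik|ik].
    apply: eq_bigr => p _; rewrite zE // tagnat.Rank1K.
    by have [->|] := eqVneq p (tagnat.sig1 k); rewrite ?ik ?orbT.
  rewrite /stacked_mean (bigD1 (tagnat.sig1 k)) //=.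
  rewrite [X in X * _](_ : _ = 0) ?mul0r //.
  by rewrite mxE tagnat.Rank1K eqxx ik.
rewrite sum_stacked_mean (bigD1 (tagnat.sig1 k)) //=; congr (_ * _).
  have -> : z k 0 = (tagnat.sig1 k == tagnat.sig1 k)%:R * z k 0.
    by rewrite eqxx mul1r.
  rewrite -(sum_Rank_eq_mul _ _ (fun l => z l 0)).
  apply: eq_bigr => j _; rewrite mxE tagnat.Rank1K eqxx /=.
  by case: eqVneq => // ->; rewrite mxE eqxx andbF.
apply: eq_bigr => p pk; apply: eq_bigr => j _.
by rewrite zE // tagnat.Rank1K pk.
Qed.

(** Each log-mass expands as x_i ln m_i - m_i - ln x_i! with m_i the product of
    the coordinates picked by i.  The mass function takes the default value 1
    at nonpositive means, hence the restriction to the positive cone. *)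
Lemma loglikE x y : (forall k, 0 < y k 0) ->
  loglik x y = \sum_k stacked_counts x k 0 * ln (y k 0)
    - \prod_(p < P) block_sum y p
    - \sum_(i : multi_index N) ln ((x i)`!%:R : R).
Proof.
move=> y0.
have lnprod (I : finType) (F : I -> R) : (forall i, 0 < F i) ->
    ln (\prod_i F i) = \sum_i ln (F i).
  move=> F0.
  suff [] : 0 < \prod_i F i /\ ln (\prod_i F i) = \sum_i ln (F i) by [].
  apply: (big_rec2 (fun a b => 0 < a /\ ln a = b)) => [|i a b _ [b0 <-]].
    by rewrite ln1.
  by split; [rewrite mulr_gt0|rewrite lnM ?posrE].
have f0 n : 0 < n`!%:R :> R by rewrite ltr0n fact_gt0.
have pmfE i : poisson_pmf (rank1_mean (fun p => submxcol y p) i) (x i) =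
    stacked_mean y i ^+ x i / (x i)`!%:R * expR (- stacked_mean y i).
  by rewrite /poisson_pmf rank1_meanE stacked_mean_gt0.
rewrite /loglik (eq_bigr _ (fun i _ => pmfE i)) lnprod; last first.
  move=> i; rewrite !mulr_gt0 ?invr_gt0 ?expR_gt0 ?exprn_gt0 //.
  exact: stacked_mean_gt0.
transitivity (\sum_i ((x i)%:R * (\sum_(p < P) ln (y (tagnat.Rank p (i p)) 0))
                     - stacked_mean y i - ln ((x i)`!%:R : R))).
  apply: eq_bigr => i _; have m0 := stacked_mean_gt0 i y0.
  rewrite !lnM ?posrE ?mulr_gt0 ?invr_gt0 ?expR_gt0 ?exprn_gt0 //.
  by rewrite expRK lnV ?posrE // lnXn // lnprod // mulr_natl addrAC.
rewrite !sumrB sum_stacked_mean; congr (_ - _ - _).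
(* Regroup the log-terms of each mode by the category they fall in. *)
rewrite sum_stacked; under eq_bigr do rewrite mulr_sumr.
rewrite exchange_big; apply: eq_bigr => p _ /=.
rewrite (partition_big (fun i : multi_index N => i p) xpredT) //=.
apply: eq_bigr => j _; rewrite stacked_counts_Rank mulr_suml.
by apply: eq_bigr => i /eqP ->.
Qed.

End Counts.

(** * Directional derivatives along coordinate lines *)

Section LineDerivatives.
Context {R : realType} {n : nat}.
Implicit Types (f : 'cV[R]_n -> R) (y v : 'cV[R]_n) (j k : 'I_n).

(** A derivative along [v] is a derivative at 0 in one real variable, where the
    one-variable chain rule applies. *)
Lemma is_derive_line f y v df :
  is_derive (0 : R) 1 (fun h : R => f (h *: v + y)) df -> is_derive y v f df.
Proof.
case=> d0 <-; apply: DeriveDef; first exact/derivable1P.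
rewrite /derive; congr (lim (_ @ 0^')); apply/funext => h /=.
by rewrite scale0r add0r addr0 [_%:A]mulr1.
Qed.

Lemma is_derive_coord (F : R -> R) dF y j k :
  is_derive (y k 0) 1 F dF ->
  is_derive y (delta_mx j 0) (fun z => F (z k 0)) ((j == k)%:R * dF).
Proof.
move=> dFk; apply: is_derive_line.
have lineE (h : R) : (h *: delta_mx j 0 + y) k 0 = h * (j == k)%:R + y k 0.
  by rewrite !mxE eqxx andbT eq_sym.
have -> : (fun h : R => F ((h *: delta_mx j 0 + y) k 0)) =
    F \o (fun h : R => h * (j == k)%:R + y k 0).
  by apply/funext => h /=; rewrite lineE.
rewrite mulrC; apply: is_derive1_comp.
  by rewrite mul0r add0r.
by apply: is_derive_eq; rewrite addr0 scaler0 add0r [_ *: 1]mulr1.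
Qed.

Lemma near_gt0_coords y : (forall k, 0 < y k 0) ->
  \forall z \near y, forall k : 'I_n, 0 < (z : 'cV[R]_n) k 0.
Proof.
move=> y0; near=> z => k; move: k; near: z; apply: filter_forall => k.
have /cvgr_gt := @coord_continuous R n 1 k 0 y.
by apply.
Unshelve. all: by end_near. Qed.

End LineDerivatives.

(** * First and second derivatives of the loglikelihood *)

Section LoglikDerivatives.
Context {R : realType} {P : nat} {N : 'I_P -> nat}.
Implicit Types (x : count_tensor N) (y : 'cV[R]_(\sum_(p < P) N p)).
Implicit Types (p : 'I_P) (j k : 'I_(\sum_(p < P) N p)).

Lemma block_sum_line (h : R) j y p :
  block_sum (h *: delta_mx j 0 + y) p =
  h * (p == tagnat.sig1 j)%:R + block_sum y p.
Proof.
rewrite -sum_Rank_eq mulr_sumr -big_split; apply: eq_bigr => l _.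
by rewrite !mxE eqxx andbT.
Qed.

(** Along the [j]-th coordinate line only the block sum of [sig1 j] moves, and
    it moves at unit speed, so the product is affine there.  The predicate [Q]
    lets one lemma serve both the full product and the partial product left by
    a first differentiation. *)
Lemma is_derive_prod_block_sum (Q : pred 'I_P) y j :
  is_derive y (delta_mx j 0)
    (fun z => \prod_(p < P | Q p) block_sum z p)
    ((Q (tagnat.sig1 j))%:R *
     \prod_(p < P | Q p && (p != tagnat.sig1 j)) block_sum y p).
Proof.
set q := tagnat.sig1 j; apply: is_derive_line.
have lineE p (h : R) : p != q ->
    block_sum (h *: delta_mx j 0 + y) p = block_sum y p.
  by move=> /negPf pq; rewrite block_sum_line pq mulr0 add0r.
have [Qq|/negPf Qq] := boolP (Q q); last first.
  rewrite mul0r.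
  rewrite [X in is_derive _ _ X](_ : _ = cst (\prod_(p | Q p) block_sum y p)).
    exact: is_derive_cst.
  apply/funext => h; apply: eq_bigr => p Qp; apply: lineE.
  by apply: contraTneq Qp => ->; rewrite Qq.
set c := \prod_(p | _) _.
rewrite [X in is_derive _ _ X](_ : _ = (fun h : R => c *: (h + block_sum y q))).
  by apply: is_derive_eq; rewrite addr0 mul1r [_ *: 1]mulr1.
apply/funext => h; rewrite (bigD1 q) //= block_sum_line eqxx mulr1 mulrC.
by congr (_ * _); apply: eq_bigr => p /andP[_]; exact: lineE.
Qed.

Definition score x y k : R :=
  stacked_counts x k 0 / y k 0 -
  \prod_(p < P | p != tagnat.sig1 k) block_sum y p.

(** The positive cone, where the closed form [loglikE] is valid, is open, and
    a derivative at [y] only sees a neighbourhood of [y]. *)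
Lemma is_derive_loglik x y k : (forall l, 0 < y l 0) ->
  is_derive y (delta_mx k 0) (loglik x) (score x y k).
Proof.
move=> y0; set c : 'cV[R]_(\sum_(p < P) N p) := stacked_counts x.
pose g (z : 'cV[R]_(\sum_(p < P) N p)) :=
  \sum_l c l 0 * ln (z l 0) - \prod_(p < P) block_sum z p
  - \sum_(i : multi_index N) ln ((x i)`!%:R : R).
apply: (@near_eq_is_derive _ _ _ g).
  near=> z; apply/esym/loglikE; near: z; exact: near_gt0_coords.
have dln : is_derive y (delta_mx k 0)
    (\sum_l (c l 0 \*: (fun z : 'cV[R]_(\sum_(p < P) N p) => ln (z l 0))))
    (\sum_l c l 0 *: ((k == l)%:R * (y l 0)^-1)).
  by apply: is_derive_sum => l; apply: is_deriveZ;
     apply: is_derive_coord; apply: is_derive1_ln.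
have dprod := is_derive_prod_block_sum xpredT y k.
have dcst := is_derive_cst (\sum_(i : multi_index N) ln ((x i)`!%:R : R)) y
  (delta_mx k 0).
have := is_deriveB (is_deriveB dln dprod) dcst.
rewrite subr0 mul1r -/c.
have -> : \sum_l c l 0 *: ((k == l)%:R * (y l 0)^-1) = c k 0 / y k 0.
  rewrite (bigD1 k) //= eqxx mul1r [X in _ + X]big1 ?addr0 // => l.
  by rewrite eq_sym => /negPf ->; rewrite mul0r scaler0.
congr is_derive; apply/funext => z.
by rewrite /g !fctE fct_sumE.
Unshelve. all: by end_near. Qed.

Definition score_derivative x y j k : R :=
  - (j == k)%:R * (stacked_counts x k 0 / y k 0 ^+ 2) -
  (tagnat.sig1 j != tagnat.sig1 k)%:R *
  \prod_(p < P | (p != tagnat.sig1 k) && (p != tagnat.sig1 j)) block_sum y p.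

Lemma is_derive_score x y j k : 0 < y k 0 ->
  is_derive y (delta_mx j 0) (score x ^~ k) (score_derivative x y j k).
Proof.
move=> y0.
have dinv : is_derive y (delta_mx j 0)
    (fun z : 'cV[R]_(\sum_(p < P) N p) => (z k 0)^-1)
    ((j == k)%:R * - y k 0 ^- 2).
  apply: (is_derive_coord (F := GRing.inv)).
  have := @is_deriveV R id (y k 0) 1 1; rewrite gt_eqF // => /(_ isT _).
  by rewrite [_ *: 1]mulr1; apply; exact: is_derive_id.
have := is_deriveB (is_deriveZ (stacked_counts x k 0) dinv)
  (is_derive_prod_block_sum (fun p => p != tagnat.sig1 k) y j).
congr is_derive; rewrite /score_derivative.
congr (_ - _); rewrite [LHS]mulrCA mulNr -mulrN; congr (_ * _); exact: mulrN.
Qed.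

Lemma partial_loglik x y k : (forall l, 0 < y l 0) ->
  partial (loglik x) k y = score x y k.
Proof. by move=> /(is_derive_loglik x k) [_ <-]. Qed.

Lemma is_derive_partial_loglik x y j k : (forall l, 0 < y l 0) ->
  is_derive y (delta_mx j 0) (partial (loglik x) k) (score_derivative x y j k).
Proof.
move=> y0; apply: (@near_eq_is_derive _ _ _ (score x ^~ k)).
  near=> z; apply/esym/partial_loglik; near: z; exact: near_gt0_coords.
exact: is_derive_score.
Unshelve. all: by end_near. Qed.

Lemma twice_derivable_loglik x y : (forall l, 0 < y l 0) ->
  twice_derivable (loglik x) y.
Proof.
move=> y0; split=> [|j k].
  near=> z => k; apply/ex_derive/is_derive_loglik.
  near: z; exact: near_gt0_coords.
exact/ex_derive/is_derive_partial_loglik.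
Unshelve. all: by end_near. Qed.

Lemma observed_infoE x y j k : (forall l, 0 < y l 0) ->
  observed_info y x j k = - score_derivative x y j k.
Proof.
by move=> /(is_derive_partial_loglik x j k) [_ <-]; rewrite !mxE.
Qed.

End LoglikDerivatives.

(** * The mean of a Poisson variable *)

Section PoissonMean.
Context {R : realType}.
Local Open Scope ereal_scope.

Lemma measurable_RV_nat {d} {T : measurableType d} {Pr : probability T R}
    (X : {RV Pr >-> nat}) (r : R) :
  measurable_fun [set: T] (EFin \o (fun w => r * (X w)%:R)%R : T -> \bar R).
Proof.
apply/measurable_EFinP.
exact: (measurableT_comp (f := (fun n : nat => r * n%:R)%R)).
Qed.

(** The shift identity (n+1) pmf(n+1) = m pmf(n) reduces the mean to the total
    mass. *)
Lemma poisson_mean (m : R) : (0 < m)%R ->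
  \sum_(0 <= n <oo) (n%:R * poisson_pmf m n)%:E = m%:E.
Proof.
move=> m0.
have pmf0 n : 0 <= (poisson_pmf m n)%:E by rewrite lee_fin poisson_pmf_ge0.
have total : \sum_(0 <= n <oo) (poisson_pmf m n)%:E = 1.
  have : poisson_prob m 0 [set: nat] = 1 := probability_setT _.
  by rewrite /poisson_prob m0 nneseries_esumT.
rewrite nneseries_recl//; last first.
  by move=> n _; rewrite lee_fin mulr_ge0 ?poisson_pmf_ge0.
rewrite mul0r add0e.
rewrite -(nneseries_addn (f := fun n => (n%:R * poisson_pmf m n)%:E) 1);
  last first.
  by move=> n; rewrite lee_fin mulr_ge0 ?poisson_pmf_ge0.
rewrite -[RHS]mule1 -total -nneseriesZl//; apply: eq_eseriesr => n _.
rewrite -EFinM addn1 /poisson_pmf m0; congr EFin.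
have n0 : (n.+1%:R != 0 :> R)%R by rewrite pnatr_eq0.
have f0 : (n`!%:R != 0 :> R)%R by rewrite pnatr_eq0 -lt0n fact_gt0.
rewrite factS natrM exprS; field.
by rewrite f0 addrC natr1 n0.
Qed.

(** The level sets of [X] partition the sample space, and the integrand is
    constant on each of them. *)
Lemma poisson_RV_mean {d} {T : measurableType d} {Pr : probability T R}
    (X : {RV Pr >-> nat}) (m : R) : (0 < m)%R ->
  (forall U, distribution Pr X U = poisson_prob m 0 U) ->
  \int[Pr]_w (X w)%:R%:E = m%:E.
Proof.
move=> m0 Xm.
have -> : [set: T] = \bigcup_n (X @^-1` [set n]).
  by apply/seteqP; split => // w _; exists (X w).
rewrite ge0_integral_bigcup//=.
- rewrite -(poisson_mean m0); apply: eq_eseriesr => n _.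
  rewrite (eq_integral (cst n%:R%:E)); last by move=> w /[1!inE] /= ->.
  rewrite integral_cst//=; last first.
    by rewrite -[X in measurable X]setTI; exact: measurable_funP.
  rewrite EFinM; congr *%E.
  rewrite [LHS](Xm [set n]) /poisson_prob m0 esum_set1//.
  by rewrite lee_fin poisson_pmf_ge0.
- by move=> n; rewrite -[X in measurable X]setTI; exact: measurable_funP.
- apply: measurable_funTS; have := measurable_RV_nat X 1.
  by under eq_fun do rewrite mul1r.
- apply/trivIsetP => i j _ _ /eqP ij.
  by apply/seteqP; split => // w [/= -> /ij].
Qed.

End PoissonMean.

(** * Entries of the information matrices *)

Section InformationEntries.
Context {R : realType} {P : nat} {N : 'I_P -> nat}.
Context {y : 'cV[R]_(\sum_(p < P) N p)} (y_gt0 : forall k, 0 < y k 0).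
Implicit Types (p q : 'I_P) (j k : 'I_(\sum_(p < P) N p)).

Lemma block_sum_gt0 p (j : 'I_(N p)) : 0 < block_sum y p.
Proof.
rewrite /block_sum (bigD1 j) //= ltr_wpDr ?y_gt0 //.
by apply: sumr_ge0 => l _; rewrite ltW.
Qed.

Lemma observed_info_same_block (x : count_tensor N) p (j l : 'I_(N p)) :
  observed_info y x (tagnat.Rank p j) (tagnat.Rank p l) =
  (j == l)%:R * (mode_sum R x p l 0 / y (tagnat.Rank p l) 0 ^+ 2).
Proof.
rewrite observed_infoE // /score_derivative !tagnat.Rank1K eqxx mul0r subr0.
by rewrite mulNr opprK eq_RankE stacked_counts_Rank mode_sumE.
Qed.

Lemma observed_info_cross_block (x : count_tensor N) p q
    (j : 'I_(N p)) (l : 'I_(N q)) : p != q ->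
  observed_info y x (tagnat.Rank p j) (tagnat.Rank q l) =
  (\prod_(r < P) block_sum y r) * (block_sum y p * block_sum y q)^-1.
Proof.
move=> pq; have jl : tagnat.Rank p j != tagnat.Rank q l.
  by apply: contra_neq pq => /(congr1 tagnat.sig1); rewrite !tagnat.Rank1K.
rewrite observed_infoE // /score_derivative !tagnat.Rank1K pq (negPf jl).
rewrite oppr0 !mul0r sub0r opprK mul1r.
rewrite [X in _ = X / _](bigD1 q) // [X in _ * X / _](bigD1 p) //=.
rewrite mulrA [block_sum y q * _]mulrC [RHS]mulrAC mulfV ?mul1r //.
by rewrite mulf_neq0 // gt_eqF // block_sum_gt0.
Qed.

Section Expectation.
Context {d : measure_display} {T : measurableType d} {Pr : probability T R}.
Context (X : multi_index N -> {RV Pr >-> nat}).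
Context (X_poisson : forall (i : multi_index N) (U : set nat),
  distribution Pr (X i) U = poisson_prob (stacked_mean y i) 0%N U).
Local Open Scope ereal_scope.

(** The mean of a marginal count is the sum of the Poisson means over its
    slice.  With [c] nonnegative every integrand is nonnegative, so integral
    and sum commute without an integrability argument. *)
Lemma expected_counts (c : R) k : (0 <= c)%R ->
  'E_Pr[fun w => c * stacked_counts (fun i => X i w) k 0]%R =
  (c * (y k 0 * \prod_(p < P | p != tagnat.sig1 k) block_sum y p)%R)%:E.
Proof.
move=> c0.
pose slice := [pred i : multi_index N |
  tagnat.Rank _ (i (tagnat.sig1 k)) == k].
transitivity (\int[Pr]_w \sum_(i <- enum slice) (c * (X i w)%:R)%:E).
  rewrite unlock; apply: eq_integral => w _.
  by rewrite big_enum sumEFin -mulr_sumr stacked_countsE.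
rewrite ge0_integral_sum //=; last 2 first.
- by move=> i; exact: measurable_RV_nat.
- by move=> i w _; rewrite lee_fin mulr_ge0.
rewrite big_enum -sum_stacked_mean_slice mulr_sumr -sumEFin.
apply: eq_bigr => i _; under eq_integral do rewrite EFinM.
rewrite ge0_integralZl //; last first.
  have := measurable_RV_nat (X i) 1.
  by under eq_fun do rewrite mul1r.
by rewrite (poisson_RV_mean _ (X_poisson i)) // stacked_mean_gt0.
Qed.

Lemma expected_info_same_block p (j l : 'I_(N p)) :
  expected_info X y (tagnat.Rank p j) (tagnat.Rank p l) =
  ((j == l)%:R * (\prod_(r < P) block_sum y r *
     ((block_sum y p)^-1 * (y (tagnat.Rank p l) 0)^-1)))%:E.
Proof.
have yl0 := y_gt0 (tagnat.Rank p l).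
rewrite mxE (_ : (fun w => _) = fun w =>
    ((j == l)%:R / y (tagnat.Rank p l) 0 ^+ 2 *
       stacked_counts (fun i => X i w) (tagnat.Rank p l) 0)%R); last first.
  apply/funext => w.
  rewrite observed_info_same_block stacked_counts_Rank mode_sumE.
  by rewrite mulrAC mulrA.
rewrite expected_counts; last by rewrite mulr_ge0 // invr_ge0 exprn_ge0 // ltW.
rewrite tagnat.Rank1K [in RHS](bigD1 p) //=; congr EFin.
have := block_sum_gt0 l; set c := (\prod_(_ | _) _)%R.
by move=> bp0; field; rewrite !gt_eqF.
Qed.

(** Across blocks the observed entry is free of the data, hence its own
    mean. *)
Lemma expected_info_cross_block p q (j : 'I_(N p)) (l : 'I_(N q)) : p != q ->
  expected_info X y (tagnat.Rank p j) (tagnat.Rank q l) =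
  (\prod_(r < P) block_sum y r * (block_sum y p * block_sum y q)^-1)%:E.
Proof.
move=> pq; rewrite mxE -(expectation_cst Pr); congr expectation.
by apply/funext => w; rewrite observed_info_cross_block.
Qed.

End Expectation.
End InformationEntries.

(** * Entries of block matrices *)

Section BlockEntries.
Context {V : nmodType} {P : nat} {N : 'I_P -> nat}.

Lemma mxblock_Rank (B : forall p q, 'M[V]_(N p, N q)) p q
    (j : 'I_(N p)) (l : 'I_(N q)) :
  (\mxblock_(p, q) B p q) (tagnat.Rank p j) (tagnat.Rank q l) = B p q j l.
Proof. by have /matrixP/(_ j l) := mxblockK B p q; rewrite mxE. Qed.

Lemma mxdiag_Rank (B : forall p, 'M[V]_(N p)) p (j l : 'I_(N p)) :
  (\mxdiag_p B p) (tagnat.Rank p j) (tagnat.Rank p l) = B p j l.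
Proof. by rewrite mxblock_Rank eqxx conform_mx_id. Qed.

Lemma mxdiag_Rank_neq (B : forall p, 'M[V]_(N p)) p q
    (j : 'I_(N p)) (l : 'I_(N q)) : p != q ->
  (\mxdiag_p B p) (tagnat.Rank p j) (tagnat.Rank q l) = 0.
Proof. by rewrite mxblock_Rank => /negPf ->; rewrite mxE. Qed.

Lemma matrix_RankP (A B : 'M[V]_(\sum_(p < P) N p)) :
  (forall p q j l, A (tagnat.Rank p j) (tagnat.Rank q l) =
                   B (tagnat.Rank p j) (tagnat.Rank q l)) -> A = B.
Proof.
move=> AB; apply/matrixP => j l.
by rewrite -(tagnat.sig2K j) -(tagnat.sig2K l) AB.
Qed.

End BlockEntries.

Lemma invmx_diag (F : fieldType) (n : nat) (u : 'rV[F]_n) :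
  (forall j, u 0 j != 0) ->
  invmx (diag_mx u) = diag_mx (\row_j (u 0 j)^-1).
Proof.
move=> u0; set D := diag_mx (\row_j _).
have uD : diag_mx u *m D = 1%:M.
  by rewrite mulmx_diag -diag_const_mx; congr diag_mx;
     apply/rowP => j; rewrite !mxE mulfV.
have [u_unit _] := mulmx1_unit uD.
by rewrite -[LHS]mulmx1 -uD mulKmx.
Qed.

(** * The theorem *)

Theorem lemma4 (R : realType) (P : nat) (N : 'I_P -> nat)
    (P_gt0 : (0 < P)%N) (N_gt0 : forall p : 'I_P, (0 < N p)%N)
    (a : forall p : 'I_P, 'cV[R]_(N p))
    (a_gt0 : forall (p : 'I_P) (j : 'I_(N p)), 0 < a p j 0)
    (x : count_tensor N)
    (x_gt0 : forall (p : 'I_P) (j : 'I_(N p)), 0 < mode_sum R x p j 0)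
    (d : measure_display) (T : measurableType d) (Pr : probability T R)
    (X : multi_index N -> {RV Pr >-> nat})
    (X_model : rank1_PCP_model X (\mxcol_(p < P) a p)) :
  let theta : 'cV[R]_(\sum_(p < P) N p) := \mxcol_(p < P) a p in
  let lam (p : 'I_P) : R := \sum_(j < N p) a p j 0 in
  let lambda : R := \prod_(p < P) lam p in
  let lam2 (p q : 'I_P) : R := lam p * lam q in
  [/\ forall y : count_tensor N, twice_derivable (loglik y) theta,
      observed_info theta x =
        \mxdiag_(p < P) diag_mx (\row_(j < N p)
            (mode_sum R x p j 0 / a p j 0 ^+ 2))
        + \mxblock_(p < P, q < P)
            (if p == q then 0
             else (lambda * (lam2 p q)^-1) *: (ones R (N p) *m (ones R (N q))^T))
    & expected_info X theta =
        map_mx EFin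
          (lambda *:
            (\mxdiag_(p < P) ((lam p)^-1 *: invmx (diag_mx (a p)^T))
             + \mxblock_(p < P, q < P)
                 (if p == q then 0
                  else (lam2 p q)^-1 *: (ones R (N p) *m (ones R (N q))^T))))].
Proof.
case: X_model => _ X_poisson theta lam lambda lam2.
have thetaE p j : theta (tagnat.Rank p j) 0 = a p j 0.
  by have /matrixP/(_ j 0) := mxcolK a p; rewrite mxE.
have theta_gt0 k : 0 < theta k 0 by rewrite mxE.
have lamE p : block_sum theta p = lam p by apply: eq_bigr => j _.
have lambdaE : \prod_(p < P) block_sum theta p = lambda by apply: eq_bigr.
have onesE m n i j : (ones R m *m (ones R n)^T) i j = 1.
  by rewrite mxE big_ord1 !mxE mulr1.
split; first by move=> y; exact: twice_derivable_loglik.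
- apply: matrix_RankP => p q j l; rewrite [RHS]mxE.
  have [pq|pq] := eqVneq p q.
    case: q / pq in l *; rewrite observed_info_same_block // thetaE.
    rewrite mxdiag_Rank mxblock_Rank.
    by rewrite eqxx !mxE addr0 mulr_natl mulrb; case: eqP => // ->.
  rewrite observed_info_cross_block // mxdiag_Rank_neq // mxblock_Rank.
  rewrite (negPf pq).
  by rewrite mxE onesE mulr1 add0r !lamE lambdaE.
- have {}X_poisson i U : distribution Pr (X i) U =
      poisson_prob (stacked_mean theta i) 0 U.
    by rewrite X_poisson rank1_meanE.
  apply: matrix_RankP => p q j l.
  rewrite [RHS]mxE [X in X%:E]mxE [X in (_ * X)%:E]mxE.
  have [pq|pq] := eqVneq p q.
    case: q / pq in l *.
    rewrite expected_info_same_block // thetaE lamE lambdaE.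
    rewrite mxdiag_Rank mxblock_Rank.
    rewrite eqxx invmx_diag => [|r]; last by rewrite mxE gt_eqF.
    rewrite !mxE addr0.
    by case: eqP => [->|]; rewrite ?mulr1n ?mulr0n ?mulr0 ?mul1r ?mul0r.
  rewrite expected_info_cross_block // mxdiag_Rank_neq // mxblock_Rank.
  rewrite (negPf pq).
  by rewrite mxE onesE mulr1 add0r !lamE lambdaE.
Qed.
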